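(* Let $\alpha\ge0$ and $\tau\in\{1,\dots,N\}$, and suppose the state $\boldsymbol{x}_\tau$ of the DPV system has a bounded probability density $\psi_{\boldsymbol{x}}(\cdot;\tau)$ on $\mathbb{R}^n$. Then $$\{\overline{y}\in\mathbb{R}^n:\phi_{\boldsymbol{x}}(\overline{y};\tau)\ge\alpha\}\subseteq\left\{\overline{z}\in\mathbb{R}^n:\psi_{\boldsymbol{x}}(\overline{z};\tau)\ge\frac{\alpha}{\mathrm{m}(\mathcal{O}(\overline{0}))}\right\}\oplus\mathcal{O}(\overline{0}).$$
   Context: DPV system (discrete-time affine parameter-varying stochastic system). Fix $N,n,m,p,l\ge 1$, a finite set $\mathcal{P}\subset\mathbb{R}^l$ and maps $A:\mathcal{P}\to\mathbb{R}^{n\times n}$, $B:\mathcal{P}\to\mathbb{R}^{n\times m}$, $F:\mathcal{P}\to\mathbb{R}^{n\times p}$. For $t=0,\dots,N-1$, $$\boldsymbol{x}_{t+1}=A(\overline\lambda_t)\boldsymbol{x}_t+B(\overline\lambda_t)\overline{u}_t+F(\overline\lambda_t)\boldsymbol{w}_t,$$ where $\boldsymbol{x}_0=\overline{x}_0\in\mathbb{R}^n$, the parameters $\overline\lambda_t\in\mathcal{P}$ and the inputs $\overline{u}_t\in\mathbb{R}^m$ are known and deterministic, and $\boldsymbol{w}_0,\dots,\boldsymbol{w}_{N-1}$ are IID random vectors in $\mathbb{R}^p$ with a density. Obstacle: let $h_{\mathrm{obs}}:\mathbb{R}^n\to\mathbb{R}$ be Borel and $\mathcal{O}(\overline{c})=\{\overline{z}\in\mathbb{R}^n:h_{\mathrm{obs}}(\overline{z}-\overline{c})\ge0\}$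 for $\overline{c}\in\mathbb{R}^n$; the shape $\mathcal{O}(\overline{0})$ is a Borel set of non-zero Lebesgue measure. The probabilistic occupancy function is $$\phi_{\boldsymbol{x}}(\overline{y};\tau)=\mathbb{P}\{\boldsymbol{x}_\tau\in\{\overline{z}\in\mathbb{R}^n:\overline{y}\in\mathcal{O}(\overline{z})\}\}.$$ $\mathrm{m}$ is Lebesgue measure and $\oplus$ the Minkowski sum. *)

(* Defs.v *)
From HB Require Import structures.
From mathcomp Require Import all_boot all_order all_algebra.
From mathcomp Require Import all_classical all_reals all_analysis measurable_realfun.

Set Implicit Arguments.
Unset Strict Implicit.
Unset Printing Implicit Defensive.

Import Order.TTheory GRing.Theory Num.Theory.
Import numFieldNormedType.Exports.

Local Open Scope classical_set_scope.
Local Open Scope ring_scope.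

(* The default measurable structure on matrices, hence on column vectors, is the
   Borel sigma-algebra of their (product) topology. *)
Section borel_matrix.
Context {R : realType} {m n : nat}.

Let borel_mx : set (set 'M[R]_(m, n)) := <<s @open 'M[R]_(m, n) >>.

Let borel_mx0 : borel_mx set0.
Proof. exact: sigma_algebra0. Qed.

Let borel_mxC A : borel_mx A -> borel_mx (~` A).
Proof. exact: sigma_algebraC. Qed.

Let borel_mx_bigcup (F : (set 'M[R]_(m, n))^nat) :
  (forall i, borel_mx (F i)) -> borel_mx (\bigcup_i F i).
Proof. exact: sigma_algebra_bigcup. Qed.

HB.instance Definition _ := @isMeasurable.Build default_measure_display
  'M[R]_(m, n) borel_mx borel_mx0 borel_mxC borel_mx_bigcup.

End borel_matrix.

Section borel_matrix_theory.
Context {R : realType} {m n : nat}.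

Lemma open_measurable_mx (U : set 'M[R]_(m, n)) : open U -> measurable U.
Proof. by move=> oU; exact: sub_sigma_algebra. Qed.

Lemma measurable_mx_coord (i : 'I_m) (j : 'I_n) :
  measurable_fun [set: 'M[R]_(m, n)] (fun M : 'M[R]_(m, n) => M i j).
Proof.
apply: (measurability _ (RGenOpens.measurableE R)).
move=> _ [_ [a [b ->]] <-]; rewrite setTI; apply: open_measurable_mx.
apply: (@open_comp _ _ (fun M : 'M[R]_(m, n) => M i j)).
  by move=> M _; exact: coord_continuous.
exact: interval_open.
Qed.

Lemma measurable_fun_mxP d (T : measurableType d) (f : T -> 'M[R]_(m, n)) :
  (forall i j, measurable_fun [set: T] (fun t => f t i j)) ->
  measurable_fun [set: T] f.
Proof.
move=> mf.
pose box (q : 'M[rat]_(m, n) * nat) : set 'M[R]_(m, n) :=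
  [set M | forall i j, `|ratr (q.1 i j) - M i j| < q.2.+1%:R^-1].
have mbox q : measurable (f @^-1` box q).
  have -> : f @^-1` box q = \bigcap_i \bigcap_j
      ((fun t => f t i j) @^-1` ball (ratr (q.1 i j) : R) q.2.+1%:R^-1).
    by apply/seteqP; split=> [t ft i _ j _|t ft i j]; [exact: ft|exact: ft].
  apply: fin_bigcap_measurable => // i _; apply: fin_bigcap_measurable => // j _.
  rewrite -[X in measurable X]setTI; apply: mf => //.
  by apply: open_measurable; apply: ball_open; rewrite invr_gt0.
apply: (@measurability _ _ _ _ _ _ (@open 'M[R]_(m, n))) => //.
move=> _ [U oU <-]; rewrite setTI.
have -> : f @^-1` U = \bigcup_(q in [set q | box q `<=` U]) (f @^-1` box q).
  apply/seteqP; split => [t /= Ut|t [q qU] /=]; last exact: qU.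
  have := oU; rewrite openE => /(_ _ Ut); rewrite /interior.
  rewrite -nbhs_ballE => -[e /= e0 eU].
  have [k ke] : exists k, 2 * k.+1%:R^-1 < e :> R.
    have [k _ /(_ k (leqnn k))] := near_infty_natSinv_lt (PosNum (divr_gt0 e0 (ltr0n R 2))).
    by rewrite /= => ke; exists k; rewrite mulrC -ltr_pdivlMr.
  have k0 : 0 < k.+1%:R^-1 :> R by rewrite invr_gt0.
  have qP (i : 'I_m) (j : 'I_n) : exists q : rat,
      `|ratr q - f t i j| < k.+1%:R^-1.
    have : f t i j - k.+1%:R^-1 < f t i j + k.+1%:R^-1.
      by rewrite ltrD2l gtrN.
    move=> /rat_in_itvoo[q]; rewrite in_itv/= => /andP[q1 q2].
    by exists q; rewrite ltr_distl q1 q2.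
  pose q := (\matrix_(i, j) projT1 (cid (qP i j)), k).
  have qE i j : `|ratr (q.1 i j) - f t i j| < k.+1%:R^-1.
    by rewrite /q /= mxE; exact: (projT2 (cid (qP i j))).
  exists q => //= M qM; apply: eU; split => // i j.
  apply: lt_trans ke; rewrite /ball /=.
  rewrite -(subrKA (ratr (q.1 i j))) mulr2n mulrDl mul1r.
  by rewrite (le_lt_trans (ler_normD _ _))// ltrD// distrC.
rewrite bigcup_mkcond; apply: countable_bigcupT_measurable => [|q].
  exact: countableP.
by case: ifP.
Qed.

End borel_matrix_theory.

(* Lebesgue measure on R^n.+1 is the image of the product of Lebesgue measure on
   R with Lebesgue measure on R^n under (x, v) |-> the vector x, v_0, ..., v_n-1.
   The library registers sigma-finiteness of product measures only for
   subprobabilities, hence the direct proof below. *)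
Section lebesgue_step.
Context {R : realType} {n : nat}.
Variable mu : {sigma_finite_measure set 'cV[R]_n -> \bar R}.

Definition consv (xv : measurableTypeR R * 'cV[R]_n) : 'cV[R]_n.+1 :=
  \col_i oapp (fun j => xv.2 j 0) xv.1 (unlift ord0 i).

Definition unconsv (v : 'cV[R]_n.+1) : measurableTypeR R * 'cV[R]_n :=
  (v ord0 0, \col_j v (lift ord0 j) 0).

Lemma consvK : cancel consv unconsv.
Proof.
move=> [x v]; rewrite /unconsv; congr pair; first by rewrite mxE unlift_none.
by apply/matrixP => i j; rewrite !mxE liftK ord1.
Qed.

Lemma measurable_consv : measurable_fun [set: _] consv.
Proof.
apply: measurable_fun_mxP => i j; have [k|] := unliftP ord0 i => ->.
  rewrite [X in measurable_fun _ X](_ : _ = (fun v : 'cV[R]_n => v k 0) \o snd).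
    by apply: measurableT_comp => //; exact: measurable_mx_coord.
  by apply/funext => xv; rewrite /= mxE liftK.
rewrite [X in measurable_fun _ X](_ : _ = fst)//.
by apply/funext => xv; rewrite mxE unlift_none.
Qed.

Lemma measurable_unconsv : measurable_fun [set: _] unconsv.
Proof.
apply: measurable_fun_pair; first exact: measurable_mx_coord.
apply: measurable_fun_mxP => i j.
rewrite [X in measurable_fun _ X](_ : _ =
  fun v : 'cV[R]_n.+1 => v (lift ord0 i) 0); first exact: measurable_mx_coord.
by apply/funext => v; rewrite mxE.
Qed.

Definition lebesgue_step : set 'cV[R]_n.+1 -> \bar R :=
  pushforward (@lebesgue_measure R \x mu)%E consv.

Let lebesgue_step0 : lebesgue_step set0 = 0%E.
Proof. by rewrite /lebesgue_step /pushforward preimage_set0 measure0. Qed.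

Let lebesgue_step_ge0 A : (0 <= lebesgue_step A)%E.
Proof. by rewrite /lebesgue_step /pushforward measure_ge0. Qed.

Let lebesgue_step_sigma_additive : semi_sigma_additive lebesgue_step.
Proof. by apply: measure_semi_sigma_additive => //; exact: measurable_consv. Qed.

HB.instance Definition _ := isMeasure.Build _ _ _ lebesgue_step
  lebesgue_step0 lebesgue_step_ge0 lebesgue_step_sigma_additive.

Let lebesgue_step_sigma_finite : sigma_finite [set: 'cV[R]_n.+1] lebesgue_step.
Proof.
have /sigma_finiteP[F [TF ndF Foo]] := sigma_finiteT (@lebesgue_measure R).
have /sigma_finiteP[G [TG ndG Goo]] := sigma_finiteT mu.
exists (fun k => unconsv @^-1` (F k `*` G k)).
  apply/esym; rewrite -subTset => v _.
  have [i _ Fi] : (\bigcup_k F k) (unconsv v).1 by rewrite -TF.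
  have [j _ Gj] : (\bigcup_k G k) (unconsv v).2 by rewrite -TG.
  exists (maxn i j) => //; split.
    by move: Fi; exact/subsetPset/ndF/leq_maxl.
  by move: Gj; exact/subsetPset/ndG/leq_maxr.
move=> k; have [mFk Fk] := Foo k; have [mGk Gk] := Goo k; split.
  rewrite -[X in measurable X]setTI.
  by apply: measurable_unconsv => //; exact: measurableX.
rewrite /lebesgue_step /pushforward -comp_preimage.
rewrite (_ : unconsv \o consv = id) ?preimage_id; last first.
  by apply/funext => x /=; rewrite consvK.
by rewrite product_measure1E// lte_mul_pinfty// ge0_fin_numE.
Qed.

HB.instance Definition _ := @Measure_isSigmaFinite.Build _ _ _ lebesgue_step
  lebesgue_step_sigma_finite.

End lebesgue_step.

Fixpoint lebesgue_cV (R : realType) (n : nat) :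
    {sigma_finite_measure set 'cV[R]_n -> \bar R} :=
  if n is n'.+1 then lebesgue_step (lebesgue_cV R n') else \d_(0 : 'cV[R]_0).

(* This value on half-open boxes characterizes Lebesgue measure. *)
Lemma lebesgue_cV_box (R : realType) (n : nat) (a b : 'cV[R]_n) :
  (forall i, a i 0 <= b i 0) ->
  lebesgue_cV R n [set v | forall i, a i 0 < v i 0 <= b i 0] =
  (\prod_i (b i 0 - a i 0))%:E.
Proof.
elim: n a b => [|n IH] a b ab.
  rewrite big_ord0 [X in lebesgue_cV _ _ X](_ : _ = setT); first exact: diracT.
  by apply/seteqP; split=> // v _ [].
have -> : lebesgue_cV R n.+1 = lebesgue_step (lebesgue_cV R n) :> (_ -> _) by [].
rewrite /lebesgue_step /pushforward.
pose a' : 'cV[R]_n := \col_i a (lift ord0 i) 0.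
pose b' : 'cV[R]_n := \col_i b (lift ord0 i) 0.
rewrite (_ : _ @^-1` _ = `]a ord0 0, b ord0 0]%classic `*`
    [set v : 'cV[R]_n | forall i, a' i 0 < v i 0 <= b' i 0]); last first.
  apply/seteqP; split=> -[x v] /=.
    move=> H; split=> [|i].
      by have := H ord0; rewrite mxE unlift_none /= in_itv.
    by have := H (lift ord0 i); rewrite !mxE liftK.
  move=> [xab vab] i; rewrite mxE; have [j|] := unliftP ord0 i => -> /=.
    by have := vab j; rewrite !mxE.
  by move: xab; rewrite in_itv.
rewrite product_measure1E; first last.
- rewrite (_ : [set _ | _] = \bigcap_i
    ((fun v : 'cV[R]_n => v i 0) @^-1` `]a' i 0, b' i 0]%classic)).
    apply: fin_bigcap_measurable => // i _; rewrite -[X in measurable X]setTI.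
    by apply: measurable_mx_coord => //; exact: measurable_itv.
  by apply/seteqP; split=> v /= vab i => [_|];
    have := vab i; rewrite /= in_itv/=; exact.
- exact: measurable_itv.
rewrite IH; last by move=> i; rewrite !mxE.
rewrite big_ord_recl EFinM; congr (_ * _)%E.
- rewrite [LHS](lebesgue_measure_itv `]a ord0 0, b ord0 0]) /= lte_fin.
  case: ltP => // ba; congr EFin.
  by apply/esym/eqP; rewrite subr_eq0 eq_le ba ab.
- by congr EFin; apply: eq_bigr => i _; rewrite !mxE.
Qed.

Definition is_density d (Omega : measurableType d) (R : realType)
    (P : probability Omega R) (k : nat) (X : Omega -> 'cV[R]_k)
    (f : 'cV[R]_k -> R) : Prop :=
  [/\ measurable_fun [set: 'cV[R]_k] f,
      (forall z, 0 <= f z)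
    & forall B : set 'cV[R]_k, measurable B ->
        P (X @^-1` B) = (\int[lebesgue_cV R k]_(z in B) (f z)%:E)%E].

Definition mutually_independent d d' (Omega : measurableType d)
    (T : measurableType d') (R : realType) (P : probability Omega R)
    (I : finType) (X : I -> {RV P >-> T}) : Prop :=
  forall (J : {set I}) (E : I -> set T), (forall i, measurable (E i)) ->
    P (\bigcap_(i in [set` J]) (X i @^-1` E i)) =
    (\prod_(i in J) P (X i @^-1` E i))%E.

Definition identically_distributed d d' (Omega : measurableType d)
    (T : measurableType d') (R : realType) (P : probability Omega R)
    (I : Type) (X : I -> {RV P >-> T}) : Prop :=
  forall (i j : I) (B : set T), measurable B ->
    distribution P (X i) B = distribution P (X j) B.

(* Times 0, ..., N are the elements of 'I_N.+1; for t : 'I_N, lift ord0 t is the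
   time t + 1 and widen_ord _ t is the time t. Lam is the finite parameter set,
   coerced to the type of its elements. *)
Definition dpv_trajectory (R : realType) (Omega : Type) (N n m p l : nat)
    (Lam : set 'cV[R]_l) (A : Lam -> 'M[R]_n) (B : Lam -> 'M[R]_(n, m))
    (F : Lam -> 'M[R]_(n, p)) (lam : 'I_N -> Lam) (u : 'I_N -> 'cV[R]_m)
    (x0 : 'cV[R]_n) (w : 'I_N -> Omega -> 'cV[R]_p)
    (x : 'I_N.+1 -> Omega -> 'cV[R]_n) : Prop :=
  (forall omega, x ord0 omega = x0) /\
  (forall (t : 'I_N) omega,
    x (lift ord0 t) omega =
      A (lam t) *m x (widen_ord (leqnSn N) t) omega
      + B (lam t) *m u t + F (lam t) *m w t omega).

Definition obstacle (R : realType) (n : nat) (hobs : 'cV[R]_n -> R)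
    (c : 'cV[R]_n) : set 'cV[R]_n :=
  [set z | 0 <= hobs (z - c)].

Definition occupancy d (Omega : measurableType d) (R : realType)
    (P : probability Omega R) (n : nat) (hobs : 'cV[R]_n -> R)
    (X : Omega -> 'cV[R]_n) (y : 'cV[R]_n) : \bar R :=
  P (X @^-1` [set z | obstacle hobs z y]).

Definition minkowski_sum (V : zmodType) (C D : set V) : set V :=
  [set c + d | c in C & d in D].

(* Main.v *)
(* The states z whose obstacle covers y form the set E = y - O(0), so the
   occupancy at y is the integral of psi over E, and mu E = mu (O(0)) because
   Lebesgue measure is invariant under z |-> y - z.  If y is not in the Minkowski
   sum, then psi < alpha / mu (O(0)) everywhere on E, which makes the occupancy
   strictly smaller than alpha.  When mu (O(0)) = +oo the quotient is 0, and
   nonnegativity of psi gives the contradiction at any point of E. *)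
Require Import Defs.
From HB Require Import structures.
From mathcomp Require Import all_boot all_order all_algebra.
From mathcomp Require Import all_classical all_reals all_analysis measurable_realfun.
From mathcomp Require Import ring lra.

Set Implicit Arguments.
Unset Strict Implicit.
Unset Printing Implicit Defensive.

Import Order.TTheory GRing.Theory Num.Theory.
Import numFieldNormedType.Exports.

Local Open Scope classical_set_scope.
Local Open Scope ring_scope.

(** By uniqueness of Lebesgue measure it suffices to compare values on the intervals []b, c]]. The
    reflection pulls such an interval back to [[a - c, a - b[], of the same length although the
    closed end has switched sides. *)
Lemma lebesgue_measure_reflect (R : realType) (a : R)
    (phi : {mfun measurableTypeR R >-> measurableTypeR R}) (A : set R) :
  phi =1 (fun x => a - x) -> measurable A ->
  pushforward (@lebesgue_measure R) phi A = lebesgue_measure A.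
Proof.
move=> phiE mA; apply/esym; apply: (@lebesgue_measure_unique R
  (pushforward (@lebesgue_measure R) phi)) => //= _ [[b c]] _ <-.
rewrite /pushforward /=.
rewrite (_ : _ @^-1` _ = `[a - c, a - b[%classic).
  rewrite !lebesgue_measure_itv/= !lte_fin ltrD2l ltrN2.
  by case: ifP => // _; congr EFin; ring.
by apply/seteqP; split=> x /=; rewrite phiE !in_itv/= => /andP[? ?];
  apply/andP; lra.
Qed.

Lemma ge0_integral_lebesgue_reflect (R : realType) (a : R)
    (g : measurableTypeR R -> \bar R) :
  measurable_fun [set: measurableTypeR R] g -> (forall x, (0 <= g x)%E) ->
  (\int[@lebesgue_measure R]_x g (a - x)%R =
   \int[@lebesgue_measure R]_x g x)%E.
Proof.
move=> mg g0.
have mr : measurable_fun [set: measurableTypeR R]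
    ((fun x : R => a - x) : measurableTypeR R -> measurableTypeR R).
  exact: measurable_funB.
pose phi : {mfun measurableTypeR R >-> measurableTypeR R} :=
  HB.pack ((fun x : R => a - x) : measurableTypeR R -> measurableTypeR R)
    (isMeasurableFun.Build _ _ _ _ _ mr).
transitivity (\int[pushforward (@lebesgue_measure R) phi]_x g x)%E.
  by rewrite ge0_integral_pushforward.
apply: eq_measure_integral => B mB _.
exact: (@lebesgue_measure_reflect R a).
Qed.

Lemma measurable_reflect (R : realType) (n : nat) (y : 'cV[R]_n) :
  measurable_fun [set: 'cV[R]_n] (fun z => y - z).
Proof.
apply: measurable_fun_mxP => i j.
rewrite [X in measurable_fun _ X](_ : _ = fun z : 'cV[R]_n => y i j - z i j).
  by apply: measurable_funB => //; exact: measurable_mx_coord.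
by apply/funext => z; rewrite !mxE.
Qed.

(** Induction on the dimension through sections. Reflecting in [y] sends the section at [x] to a
    reflected copy of the section at [a - x]. The induction hypothesis removes the reflection of the
    section, and a one-dimensional change of variables removes that of [x]. *)
Lemma lebesgue_cV_reflect (R : realType) (n : nat) (y : 'cV[R]_n)
    (A : set 'cV[R]_n) :
  measurable A ->
  lebesgue_cV R n ((fun z => y - z) @^-1` A) = lebesgue_cV R n A.
Proof.
elim: n y A => [|n IH] y A mA.
  (* In dimension 0 there is only one vector. *)
  congr (lebesgue_cV _ _ _); rewrite (_ : (fun z => y - z) = id) ?preimage_id//.
  by apply/funext => z; apply/matrixP => -[].
have -> : lebesgue_cV R n.+1 = lebesgue_step (lebesgue_cV R n) :> (_ -> _) by [].
rewrite /lebesgue_step /pushforward /product_measure1.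
set mu := lebesgue_cV R n.
pose A' := consv @^-1` A; pose a : R := (unconsv y).1; pose b := (unconsv y).2.
have mA' : measurable A'.
  by rewrite -[A']setTI; exact: measurable_consv.
have mg := measurable_fun_xsection mu mA'.
transitivity (\int[@lebesgue_measure R]_x (mu \o xsection A') (a - x)%R)%E.
  apply: eq_integral => x _ /=.
  rewrite -[RHS](IH b); last exact: measurable_xsection.
  congr (mu _); apply/seteqP.
  have yB v : y - consv (x, v) = consv (a - x, b - v).
    apply/matrixP => i j; rewrite !mxE ord1.
    by case: unliftP => [k|] -> /=; rewrite ?mxE.
  by split=> v; rewrite /xsection /= !inE /A' /= yB.
exact: ge0_integral_lebesgue_reflect.
Qed.

(** The gap between the two sides is the integral of [k - f]. Were it zero, [k - f] would vanish
    almost everywhere on [D]; being positive at every point of [D], it would force [D] to be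
    null. *)
Lemma integral_lt_cst d (T : measurableType d) (R : realType)
    (mu : {measure set T -> \bar R}) (D : set T) (f : T -> R) (k : R) :
  measurable D -> measurable_fun D f -> mu D != 0%E -> (mu D < +oo)%E ->
  (forall x, D x -> 0 <= f x < k) ->
  (\int[mu]_(x in D) (f x)%:E < k%:E * mu D)%E.
Proof.
move=> mD mf D0 Doo fk.
have mkf : measurable_fun D (fun x => (k - f x)%:E).
  by apply/measurable_EFinP; apply: measurable_funB.
have mEf : measurable_fun D (fun x => (f x)%:E) by exact/measurable_EFinP.
have f0 x : D x -> (0 <= (f x)%:E)%E by move=> /fk /andP[].
have kf0 x : D x -> (0 <= (k - f x)%:E)%E.
  by move=> /fk /andP[_ /ltW]; rewrite lee_fin subr_ge0.
have split_cst : (k%:E * mu D =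
    \int[mu]_(x in D) (f x)%:E + \int[mu]_(x in D) (k - f x)%:E)%E.
  rewrite -ge0_integralD// -integral_cst//; apply: eq_integral => x _.
  by rewrite -EFinD /cst; congr EFin; ring.
have kf_gt0 : (0 < \int[mu]_(x in D) (k - f x)%:E)%E.
  rewrite lt0e integral_ge0// andbT; apply: contra D0 => /eqP kfD0.
  have : (\int[mu]_(x in D) `|(k - f x)%:E| = 0)%E.
    by rewrite -kfD0; apply: eq_integral => x /[!inE] Dx; rewrite gee0_abs ?kf0.
  move=> /(ae_eq_integral_abs mu mD mkf) [N [mN N0 DN]].
  apply/eqP; apply: (subset_measure0 mD mN _ N0) => x Dx.
  apply: DN => /= /(_ Dx) [] /eqP; rewrite subr_eq0 => /eqP kE.
  by have /andP[_] := fk _ Dx; rewrite -kE ltxx.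
(* Adding a positive term is strict only if the integral of [f] is finite; it is at most [k * mu D],
   which is finite. *)
rewrite split_cst lteDl// ge0_fin_numE ?integral_ge0//.
apply: (@le_lt_trans _ _ (k%:E * mu D)%E); first by rewrite split_cst leeDl// ltW.
by rewrite -(@fineK _ (mu D)) ?ge0_fin_numE// -EFinM ltry.
Qed.

Theorem proposition8 (R : realType) (d : measure_display)
    (Omega : measurableType d) (P : probability Omega R)
    (N n m p l : nat)
    (hN : (1 <= N)%N) (hn : (1 <= n)%N) (hm : (1 <= m)%N)
    (hp : (1 <= p)%N) (hl : (1 <= l)%N)
    (Lam : set 'cV[R]_l) (finLam : finite_set Lam)
    (A : Lam -> 'M[R]_n) (B : Lam -> 'M[R]_(n, m)) (F : Lam -> 'M[R]_(n, p))
    (lam : 'I_N -> Lam) (u : 'I_N -> 'cV[R]_m) (x0 : 'cV[R]_n)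
    (w : 'I_N -> {RV P >-> 'cV[R]_p})
    (w_indep : mutually_independent w)
    (w_id : identically_distributed w)
    (w_density : exists f, forall t, is_density P (w t) f)
    (x : 'I_N.+1 -> Omega -> 'cV[R]_n)
    (x_dpv : dpv_trajectory A B F lam u x0 w x)
    (hobs : 'cV[R]_n -> R)
    (hobs_borel : measurable_fun [set: 'cV[R]_n] hobs)
    (O_borel : measurable (obstacle hobs 0))
    (O_neq0 : lebesgue_cV R n (obstacle hobs 0) != 0%E)
    (alpha : R) (alpha_ge0 : 0 <= alpha)
    (tau : 'I_N.+1) (tau_gt0 : (1 <= tau)%N)
    (psi : 'cV[R]_n -> R)
    (psi_density : is_density P (x tau) psi)
    (psi_bounded : bounded_fun psi) :
  [set y | (alpha%:E <= occupancy P hobs (x tau) y)%E] `<=`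
  minkowski_sum
    [set z | (alpha%:E / lebesgue_cV R n (obstacle hobs 0) <= (psi z)%:E)%E]
    (obstacle hobs 0).
Proof.
move=> y /=; rewrite /occupancy; case: psi_density => mpsi psi0 psiP.
set O := obstacle hobs 0 in O_borel O_neq0 *; set mu := lebesgue_cV R n in O_neq0 *.
set E : set 'cV[R]_n := (fun z => y - z) @^-1` O.
have mE : measurable E by rewrite -[E]setTI; exact: measurable_reflect.
have muE : mu E = mu O by exact: lebesgue_cV_reflect.
rewrite [X in P (_ @^-1` X)](_ : _ = E); last first.
  by apply/seteqP; split=> z; rewrite /E /O /obstacle /= subr0.
rewrite psiP// => alphaE; apply: contrapT => ynot.
(* Otherwise [y = z + (y - z)] would put [y] in the Minkowski sum. *)
have psi_lt z : E z -> ((psi z)%:E < alpha%:E / mu O)%E.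
  move=> Ez; rewrite ltNge; apply/negP => psiz; apply: ynot.
  by exists z => //; exists (y - z) => //; rewrite addrC subrK.
have O_gt0 : (0 < mu O)%E by rewrite lt0e O_neq0/= measure_ge0.
have [Ooo|Ofin] := eqVneq (mu O) +oo%E.
  have [z Ez] : E !=set0.
    apply/set0P; apply: contra O_neq0 => /eqP E0.
    by rewrite -muE E0 measure0.
  by have := psi_lt z Ez; rewrite Ooo invey mule0 lte_fin ltNge psi0.
have Olty : (mu O < +oo)%E by rewrite ltey.
have muOE : mu O = (fine (mu O))%:E by rewrite fineK// ge0_fin_numE// ltW.
have fineO : 0 < fine (mu O) by rewrite fine_gt0// O_gt0.
have quotE : (alpha%:E / mu O = (alpha / fine (mu O))%:E)%E.
  by rewrite muOE inver gt_eqF.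
suff : (\int[mu]_(z in E) (psi z)%:E < alpha%:E)%E by rewrite ltNge alphaE.
(* Writing [alpha] as the threshold times [mu E] makes the goal the strict bound for [psi] on
   [E]. *)
rewrite [ltRHS](_ : _ = (alpha / fine (mu O))%:E * mu E)%E; last first.
  by rewrite muE {2}muOE -EFinM divfK// gt_eqF.
apply: integral_lt_cst => //.
- exact: measurable_funS mpsi.
- by rewrite -muE in O_neq0.
- by rewrite -muE in Olty.
- by move=> z /psi_lt; rewrite quotE lte_fin psi0.
Qed.
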